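(* Let $p(z)=z^n+a_{n-1}z^{n-1}+\cdots+a_1z+a_0$ be a monic polynomial of degree $n$ with coefficients $a_0,\dots,a_{n-1}\in\mathbb{C}$, let $C(p)$ be its Frobenius companion matrix, and let $\lambda$ be a zero of $p(z)$. Then $$|\lambda|\le w(C(p))\le\sqrt{|a_{n-1}|^2+\frac12\alpha\left(|a_{n-1}|+\frac12\alpha\right)}+\sqrt{\cos^2\frac{\pi}{n}+\frac12\left(\cos\frac{\pi}{n}+\frac12\right)},$$ where $\alpha=\sqrt{\sum_{r=0}^{n-2}|a_r|^2}$.
   Context: The Frobenius companion matrix of $p$ is the $n\times n$ matrix $$C(p)=\begin{pmatrix}-a_{n-1}&-a_{n-2}&\cdots&-a_1&-a_0\\1&0&\cdots&0&0\\0&1&\cdots&0&0\\\vdots&\vdots&&\vdots&\vdots\\0&0&\cdots&1&0\end{pmatrix},$$ regarded as an operator on $\mathbb{C}^n$ with the usual inner product. The numerical radius of an operator $T$ on $\mathbb{C}^n$ is $w(T)=\sup\{|\langle Tx,x\rangle| : x\in\mathbb{C}^n,\ \|x\|=1\}$. *)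

(* Defs.v *)
From mathcomp Require Import all_boot all_order all_algebra.
From mathcomp Require Import complex.
From mathcomp Require Import boolp classical_sets reals trigo.

Set Implicit Arguments.
Unset Strict Implicit.
Unset Printing Implicit Defensive.

Import Order.TTheory GRing.Theory Num.Theory.

Local Open Scope classical_set_scope.
Local Open Scope complex_scope.
Local Open Scope ring_scope.

(* The [R]-valued modulus; the norm [`|z|] of [R[i]] is [R[i]]-valued. *)
Definition cmod (R : realType) (z : R[i]) : R := ComplexField.Normc.normc z.

(* [dotmx] acts on row vectors and is conjugate-linear in its second
   argument: [cdot u v] is the sum of the [u i 0 * (v i 0)^*]. *)
Definition cdot (R : realType) (n : nat) (u v : 'cV[R[i]]_n) : R[i] :=
  dotmx u^T v^T.

Definition cnorm (R : realType) (n : nat) (x : 'cV[R[i]]_n) : R :=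
  Num.sqrt (complex.Re (cdot x x)).

(* For [n > 0] the set is nonempty and bounded, so [sup] is the actual
   supremum; for [n = 0] it is empty and the value is [0] by convention. *)
Definition numerical_radius (R : realType) (n : nat) (T : 'M[R[i]]_n) : R :=
  sup [set cmod (cdot (T *m x) x) | x in [set x : 'cV[R[i]]_n | cnorm x = 1]].

(* Not [mxpoly.companionmx], which places the coefficients differently.
   Column [j] (counted from 0) of the first row holds [- a_(n-1-j)]. *)
Definition frobenius_companion (R : realType) (n : nat) (p : {poly R[i]}) :
    'M[R[i]]_n :=
  \matrix_(i, j) if i == 0%N :> nat then - p`_(n.-1 - j)
                 else (i == j.+1 :> nat)%:R.

(* Main.v *)
Require Import Defs.
From mathcomp Require Import all_boot all_order all_algebra.
From mathcomp Require Import complex.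
From mathcomp Require Import boolp classical_sets reals trigo.
From mathcomp Require Import ring lra.

Import Order.TTheory GRing.Theory Num.Theory.

Local Open Scope complex_scope.
Local Open Scope ring_scope.

(** Write [n = m + 1] and let [Y k] be the modulus of the [k]-th coordinate of
    a unit vector [x].  The companion matrix is the sum of its first row and of
    the shift, so the triangle inequality gives
    [|<Cx, x>| <= Y 0 * (sum_j |a_(m-j)| Y j) + sum_(k < m) Y k * Y (k+1)],
    and the two square roots of the bound estimate these two terms.

    Both estimates end in one two-dimensional inequality
    ([two_coordinate_form_le]): on the unit circle,
    [a s^2 + b s t <= sqrt (a^2 + b/2 (a + b/2))].  For the first row, isolate
    the coordinate [Y 0] and apply Cauchy-Schwarz to the others; this gives
    [a = |a_(n-1)|], [b = alpha], [s = Y 0] ([first_row_form_le]).  For the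
    shift, isolate the last coordinate instead: the first [n - 1] coordinates
    contribute at most [cos (pi / n)] times their squared norm [s^2]
    ([path_form_le]), and the remaining product at most [s t] with [t] the last
    coordinate, so [a = cos (pi / n)] and [b = 1] ([shift_form_le]).

    For the lower bound, the powers of a zero [lam] of [p] form an eigenvector
    of the companion matrix for [lam]; once normalized, it is a unit vector at
    which the quadratic form takes the value [lam].  The upper bound is needed
    here too: it makes the set of values bounded, so that its [sup] dominates
    its elements. *)

(** * Real inequalities *)

(** Cauchy-Schwarz, from the sum of the squares of
    [B u_i - P v_i], where [B] is the sum of the [v_i^2] and [P] that of the
    [u_i v_i]: up to a factor [B], it is the claimed difference. *)
Lemma sum_mul_sq_le (R : realFieldType) (n : nat) (u v : 'I_n -> R) :
  (\sum_i u i * v i) ^+ 2 <= (\sum_i u i ^+ 2) * \sum_i v i ^+ 2.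
Proof.
set P := \sum_i u i * v i; set A := \sum_i u i ^+ 2; set B := \sum_i v i ^+ 2.
have B_ge0 : 0 <= B by apply: sumr_ge0 => i _; exact: sqr_ge0.
have : 0 <= B * (A * B - P ^+ 2).
  have -> : B * (A * B - P ^+ 2) = \sum_i (B * u i - P * v i) ^+ 2.
    under eq_bigr => i _.
      have -> : (B * u i - P * v i) ^+ 2 =
        B ^+ 2 * u i ^+ 2 + (- (2 * B * P) * (u i * v i) + P ^+ 2 * v i ^+ 2).
        by ring.
      over.
    by rewrite !big_split /= -!mulr_sumr -/A -/B -/P; ring.
  by apply: sumr_ge0 => i _; exact: sqr_ge0.
have [B0|B_neq0] := eqVneq B 0.
  suff -> : P = 0 by rewrite B0 mulr0 expr0n.
  apply: big1 => i _; apply/eqP; rewrite mulf_eq0 -[v i == 0]sqrf_eq0; apply/orP; right.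
  move/eqP: B0; rewrite psumr_eq0 => [/allP/(_ i)|j _]; last exact: sqr_ge0.
  by rewrite mem_index_enum; apply.
by rewrite pmulr_rge0 ?lt0r ?B_neq0 // subr_ge0.
Qed.

(** The double angle [u = s^2 - t^2], [v = 2 s t] turns the left-hand side into
    [(a + q) / 2] with [q = a u + b v] and [u^2 + v^2 = 1].  Its square is at
    most the radicand because [q <= a + b] and [q^2 <= a^2 + b^2]. *)
Lemma two_coordinate_form_le (R : rcfType) (a b s t : R) :
  0 <= a -> 0 <= b -> s ^+ 2 + t ^+ 2 = 1 ->
  a * s ^+ 2 + b * (s * t) <= Num.sqrt (a ^+ 2 + 2^-1 * b * (a + 2^-1 * b)).
Proof.
move=> a0 b0 st1.
set u := 2 * s ^+ 2 - 1; set v := 2 * (s * t).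
have uv1 : u ^+ 2 + v ^+ 2 = 1.
  have t2 : t ^+ 2 = 1 - s ^+ 2 by rewrite -st1; ring.
  have -> : v ^+ 2 = 4 * s ^+ 2 * t ^+ 2 by rewrite /v; ring.
  by rewrite /u t2; ring.
have u_le1 : u <= 1.
  by have := sqr_ge0 t; rewrite /u; lra.
have v_le1 : v <= 1.
  have := sqr_ge0 (s - t).
  have -> : (s - t) ^+ 2 = s ^+ 2 + t ^+ 2 - v by rewrite /v; ring.
  by rewrite st1 subr_ge0.
set q := a * u + b * v.
have q_le : q <= a + b.
  by apply: lerD; apply: ler_piMr.
have q2_le : q ^+ 2 <= a ^+ 2 + b ^+ 2.
  have := sqr_ge0 (a * v - b * u).
  have -> : (a * v - b * u) ^+ 2 = (a ^+ 2 + b ^+ 2) * (u ^+ 2 + v ^+ 2) - q ^+ 2.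
    by rewrite /q; ring.
  by rewrite uv1 mulr1 subr_ge0.
have -> : a * s ^+ 2 + b * (s * t) = 2^-1 * (a + q) by rewrite /q /u /v; field.
apply: le_trans (ler_norm _) _; rewrite -sqrtr_sqr; apply: ler_wsqrtr.
have : a * q <= a * (a + b) by exact: ler_wpM2l.
by nra.
Qed.

(** The matrix of this quadratic form is half the adjacency matrix of the path
    on the vertices [0 .. m]; its Perron eigenvector has entry
    [s_(k+1)] at [k], where [s_k = sin (k th)] and [th = pi / (m + 2)].  Weighing each product by
    [2 Y_k Y_(k+1) <= (s_(k+2) / s_(k+1)) Y_k^2 + (s_(k+1) / s_(k+2)) Y_(k+1)^2]
    and using [s_k + s_(k+2) = 2 cos th * s_(k+1)] makes every [Y_k^2] appear
    with the same total weight [2 cos th]. *)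
Lemma path_form_le (R : realType) (m : nat) (Y : nat -> R) :
  \sum_(k < m) Y k * Y k.+1
    <= cos (pi / m.+2%:R) * \sum_(k < m.+1) Y k ^+ 2.
Proof.
set th := pi / m.+2%:R; set c := cos th.
pose s k := sin (k%:R * th).
have s_rec k : s k.+2 = 2 * c * s k.+1 - s k.
  have E2 : k.+2%:R * th = k.+1%:R * th + th.
    by rewrite [k.+2%:R]mulrS; ring.
  have E0 : k%:R * th = k.+1%:R * th - th by rewrite mulrS; ring.
  by rewrite /s E2 E0 sinD sinB /c; ring.
have th_gt0 : 0 < th by rewrite divr_gt0 ?pi_gt0 // ltr0n.
have s_gt0 k : (0 < k < m.+2)%N -> 0 < s k.
  case/andP=> k_gt0 k_lt; apply: sin_gt0_pi.
  rewrite mulr_gt0 ?ltr0n //= /th mulrCA gtr_pMr ?pi_gt0 //.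
  by rewrite ltr_pdivrMr ?ltr0n // mul1r ltr_nat.
have s0 : s 0%N = 0 by rewrite /s mul0r sin0.
have sN : s m.+2 = 0 by rewrite /s /th mulrC divfK ?pnatr_eq0 // sinpi.
(* The extra term is the part of the weight [2 c] of [Y j ^+ 2] that the next
   product will use; it vanishes for [j = m] since [sin pi = 0]. *)
have main j : (j <= m)%N ->
    2 * (\sum_(k < j) Y k * Y k.+1) + s j.+2 / s j.+1 * Y j ^+ 2
      <= 2 * c * \sum_(k < j.+1) Y k ^+ 2.
  elim: j => [|j IH] j_le.
    rewrite big_ord0 mulr0 add0r big_ord_recl big_ord0 addr0 s_rec s0 subr0.
    by rewrite mulfK // gt_eqF // s_gt0.
  have s1_gt0 : 0 < s j.+1 by rewrite s_gt0 //= ltnS ltnW // ltnW.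
  have s2_gt0 : 0 < s j.+2 by rewrite s_gt0 //= !ltnS.
  have {IH} := IH (ltnW j_le).
  rewrite [\sum_(k < j.+1) Y k * Y k.+1]big_ord_recr.
  rewrite [\sum_(k < j.+2) Y k ^+ 2]big_ord_recr /= (s_rec j.+1) mulrBl.
  rewrite mulfK ?gt_eqF //.
  set X := \sum_(k < j) _; set Z := \sum_(k < j.+1) _.
  have : 0 <= s j.+2 / s j.+1 * (Y j - s j.+1 / s j.+2 * Y j.+1) ^+ 2.
    by rewrite mulr_ge0 ?sqr_ge0 // divr_ge0 // ltW.
  have -> : s j.+2 / s j.+1 * (Y j - s j.+1 / s j.+2 * Y j.+1) ^+ 2
     = s j.+2 / s j.+1 * Y j ^+ 2 - 2 * (Y j * Y j.+1)
       + s j.+1 / s j.+2 * Y j.+1 ^+ 2.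
    by field; rewrite !gt_eqF.
  by lra.
have := main m (leqnn m); rewrite sN mul0r mul0r addr0 -mulrA.
by rewrite ler_pM2l ?ltr0n.
Qed.

(** Applying [path_form_le] to all coordinates would give the smaller
    bound [cos (pi / (m + 2))], whose comparison with the right-hand side is
    awkward.  Splitting off the last coordinate keeps the angle
    [pi / (m + 1)]. *)
Lemma shift_form_le (R : realType) (m : nat) (Y : nat -> R) :
  (forall k, 0 <= Y k) -> \sum_(k < m.+1) Y k ^+ 2 = 1 ->
  \sum_(k < m) Y k * Y k.+1
    <= Num.sqrt (cos (pi / m.+1%:R) ^+ 2
                 + 2^-1 * (cos (pi / m.+1%:R) + 2^-1)).
Proof.
(* For [m = 0] the cosine is [-1], but the sum is empty. *)
case: m => [|m] Y_ge0 Y1; set c := cos _; first by rewrite big_ord0 sqrtr_ge0.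
have c_ge0 : 0 <= c.
  apply: cos_ge0_pihalf; apply/andP; split.
    apply: (@le_trans _ _ 0); first by rewrite oppr_le0 divr_ge0 ?pi_ge0.
    by rewrite divr_ge0 ?pi_ge0.
  by rewrite ler_pM2l ?pi_gt0 // lef_pV2 ?posrE ?ltr0n // ler_nat.
set S := \sum_(k < m.+1) Y k ^+ 2.
have S_ge0 : 0 <= S by apply: sumr_ge0 => k _; exact: sqr_ge0.
have SY1 : Num.sqrt S ^+ 2 + Y m.+1 ^+ 2 = 1.
  by rewrite sqr_sqrtr // -Y1 big_ord_recr.
have Ym_le : Y m <= Num.sqrt S.
  rewrite -[Y m](ger0_norm (Y_ge0 m)) -sqrtr_sqr; apply: ler_wsqrtr.
  by rewrite /S big_ord_recr /= lerDr sumr_ge0 // => k _; exact: sqr_ge0.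
have := two_coordinate_form_le R c 1 _ _ c_ge0 ler01 SY1.
rewrite !mulr1 mul1r; apply: le_trans.
rewrite big_ord_recr /= sqr_sqrtr //; apply: lerD; first exact: path_form_le.
by apply: ler_wpM2r.
Qed.

Lemma first_row_form_le (R : rcfType) (m : nat) (a Y : nat -> R) (alpha : R) :
  0 <= a m -> 0 <= Y 0%N -> \sum_(k < m.+1) Y k ^+ 2 = 1 ->
  alpha = Num.sqrt (\sum_(r < m) a r ^+ 2) ->
  Y 0%N * (\sum_(j < m.+1) a (m - j)%N * Y j)
    <= Num.sqrt (a m ^+ 2 + 2^-1 * alpha * (a m + 2^-1 * alpha)).
Proof.
move=> am_ge0 Y0_ge0 Y1 ->.
set S := \sum_(j < m) Y j.+1 ^+ 2.
have S_ge0 : 0 <= S by apply: sumr_ge0 => k _; exact: sqr_ge0.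
have YS1 : Y 0%N ^+ 2 + Num.sqrt S ^+ 2 = 1.
  by rewrite sqr_sqrtr // -Y1 big_ord_recl.
apply: le_trans (two_coordinate_form_le _ _ _ _ _ am_ge0 (sqrtr_ge0 _) YS1).
rewrite big_ord_recl /= subn0 mulrDr.
have -> : Y 0%N * (a m * Y 0%N) = a m * Y 0%N ^+ 2 by ring.
rewrite lerD2l [leRHS]mulrCA; apply: ler_wpM2l => //.
apply: le_trans (ler_norm _) _; rewrite -sqrtr_sqr -sqrtrM; last first.
  by apply: sumr_ge0 => k _; exact: sqr_ge0.
apply: ler_wsqrtr; apply: le_trans (sum_mul_sq_le _ _ _ _) _.
by rewrite [X in _ <= X * _](reindex_inj rev_ord_inj).
Qed.

(** * Inner products *)

Lemma cdotE (R : realType) (n : nat) (u v : 'cV[R[i]]_n) :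
  cdot u v = \sum_i u i 0 * (v i 0)^*%C.
Proof. by rewrite /cdot dotmxE mxE; apply: eq_bigr => i _; rewrite !mxE. Qed.

Lemma cmodJ (R : realType) (z : R[i]) : cmod z^*%C = cmod z.
Proof. by case: z => x y; rewrite /cmod /= sqrrN. Qed.

Lemma cmod_ge0 (R : realType) (z : R[i]) : 0 <= cmod z.
Proof. by case: z => x y; exact: sqrtr_ge0. Qed.

Lemma cmod_sum_le (R : realType) (I : Type) (r : seq I) (F : I -> R[i]) :
  cmod (\sum_(i <- r) F i) <= \sum_(i <- r) cmod (F i).
Proof.
elim/big_rec2: _ => [|i y x _ IH]; first by rewrite /cmod ComplexField.Normc.normc0.
by apply: le_trans (le_normcD _ _) _; rewrite lerD2l.
Qed.

Lemma cmod_cdot_le (R : realType) (n : nat) (u v : 'cV[R[i]]_n) :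
  cmod (cdot u v) <= \sum_i cmod (u i 0) * cmod (v i 0).
Proof.
rewrite cdotE; apply: le_trans (cmod_sum_le _ _ _ _) _.
apply: ler_sum => i _.
by rewrite [leLHS]ComplexField.Normc.normcM -/(cmod _) -/(cmod _) cmodJ.
Qed.

Lemma cdot_self (R : realType) (n : nat) (x : 'cV[R[i]]_n) :
  cdot x x = (\sum_i cmod (x i 0) ^+ 2)%:C.
Proof.
rewrite cdotE rmorph_sum; apply: eq_bigr => i _.
rewrite rmorphXn /= -[X in X ^+ 2]/(`|x i 0|).
by rewrite sqr_normc.
Qed.

Lemma cnormE (R : realType) (n : nat) (x : 'cV[R[i]]_n) :
  cnorm x = Num.sqrt (\sum_i cmod (x i 0) ^+ 2).
Proof. by rewrite /cnorm cdot_self. Qed.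

(** * The companion matrix *)

Lemma companion_form_le (R : realType) (m : nat) (p : {poly R[i]})
    (x : 'cV[R[i]]_m.+1) :
  forall Y : nat -> R, (forall k : 'I_m.+1, cmod (x k 0) = Y k) ->
  cmod (cdot (frobenius_companion m.+1 p *m x) x)
    <= Y 0%N * (\sum_(j < m.+1) cmod p`_(m - j) * Y j)
       + \sum_(k < m) Y k * Y k.+1.
Proof.
move=> Y YE.
apply: le_trans (cmod_cdot_le _ _ _ _) _.
rewrite big_ord_recl; apply: lerD.
  rewrite mulrC (YE ord0).
  apply: ler_wpM2l; first by rewrite -(YE ord0) cmod_ge0.
  rewrite mxE; apply: le_trans (cmod_sum_le _ _ _ _) _.
  apply: ler_sum => j _.
  by rewrite mxE /= /cmod ComplexField.Normc.normcM normcN -/(cmod _) -/(cmod _) YE.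
apply: ler_sum => k _.
have kE : (lift ord0 k : nat) = k.+1 by rewrite lift0.
rewrite mxE (bigD1 (widen_ord (leqnSn m) k)) //= big1 => [|j jk].
  by rewrite addr0 mxE kE /= eqxx mul1r !YE kE.
rewrite mxE kE /= eqSS; case: eqP => [kj|]; last by rewrite mul0r.
by case/eqP: jk; apply: val_inj.
Qed.

(** The shift rows of the matrix force the entries to be decreasing powers of
    [lam]; the first row then says that [p] vanishes at [lam]. *)
Lemma companion_eigenvector (F : realType) (m : nat) (p : {poly F[i]})
    (lam : F[i]) :
  p \is monic -> size p = m.+2 -> root p lam ->
  let x : 'cV[F[i]]_m.+1 := \col_(j < m.+1) lam ^+ (m - j) in
  frobenius_companion m.+1 p *m x = lam *: x.
Proof.
move=> /monicP p_monic p_size /rootP p_lam x.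
apply/colP => i; rewrite !mxE; case: (unliftP ord0 i) => [k|] -> {i}.
  have kE : (lift ord0 k : nat) = k.+1 by rewrite lift0.
  rewrite (bigD1 (widen_ord (leqnSn m) k)) //= big1 => [|j jk].
    rewrite addr0 !mxE kE /= eqxx mul1r -exprS subnS prednK //.
    by rewrite subn_gt0.
  rewrite !mxE kE /= eqSS; case: eqP => [kj|]; last by rewrite mul0r.
  by case/eqP: jk; apply: val_inj.
move: p_lam; rewrite horner_coef p_size big_ord_recr /=.
have -> : p`_m.+1 = 1 by rewrite -p_monic lead_coefE p_size.
rewrite mul1r subn0 -exprS addrC => /eqP; rewrite addr_eq0 => /eqP ->.
rewrite -sumrN [RHS](reindex_inj rev_ord_inj); apply: eq_bigr => j _.
by rewrite !mxE /= mulNr subSS.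
Qed.

(** The two inequalities are proved together because each needs what the other
    provides: [lam] lies below the [sup] because [M] bounds the set, and the
    [sup] of a set without elements would be [0], possibly above [M], so the
    second inequality uses the normalized eigenvector. *)
Lemma numerical_radius_eigenvalue (R : realType) (n : nat) (T : 'M[R[i]]_n)
    (lam : R[i]) (x : 'cV[R[i]]_n) (M : R) :
  (forall y, cnorm y = 1 -> cmod (cdot (T *m y) y) <= M) ->
  x != 0 -> T *m x = lam *: x ->
  cmod lam <= numerical_radius T <= M.
Proof.
move=> T_le x_neq0 Tx.
have N_gt0 : 0 < cnorm x.
  rewrite cnormE sqrtr_gt0 lt0r sumr_ge0 ?andbT => [|i _]; last exact: sqr_ge0.
  apply: contra x_neq0; rewrite psumr_eq0 => [/allP x0|i _]; last exact: sqr_ge0.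
  apply/eqP/colP => i; rewrite mxE.
  have := x0 i (mem_index_enum _); rewrite sqrf_eq0 => /eqP.
  exact: ComplexField.Normc.eq0_normc.
set y := (cnorm x)^-1%:C *: x.
have y1 : cdot y y = 1.
  have -> : cdot y y = (cnorm x)^-1%:C * ((cnorm x)^-1%:C * cdot x x).
    rewrite !cdotE !mulr_sumr; apply: eq_bigr => i _.
    by rewrite !mxE rmorphM /= oppr0 mulrACA -mulrA.
  have -> : cdot x x = (cnorm x ^+ 2)%:C.
    rewrite cdot_self cnormE sqr_sqrtr // sumr_ge0 // => i _; exact: sqr_ge0.
  by rewrite -!rmorphM /= mulrA -expr2 exprVn mulVf // sqrf_eq0 gt_eqF.
have y_norm : cnorm y = 1 by rewrite /cnorm y1 sqrtr1.
have Ty : cmod (cdot (T *m y) y) = cmod lam.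
  rewrite -scalemxAr Tx.
  suff -> : cdot ((cnorm x)^-1%:C *: (lam *: x)) y = lam * cdot y y.
    by rewrite y1 mulr1.
  by rewrite !cdotE mulr_sumr; apply: eq_bigr => i _; rewrite !mxE; ring.
apply/andP; split; last first.
  apply: ge_sup; first by exists (cmod lam), y.
  by move=> _ [z /= z1 <-]; exact: T_le.
apply: ub_le_sup; last by exists y.
by exists M => _ [z /= z1 <-]; exact: T_le.
Qed.

Theorem theorem3p7 (R : realType) (n : nat) (p : {poly R[i]})
    (p_monic : p \is monic) (p_size : size p = n.+1)
    (lam : R[i]) (lam_root : root p lam) :
  let a := fun k : nat => cmod p`_k in
  let alpha := Num.sqrt (\sum_(r < n.-1) a r ^+ 2) in
  let w := numerical_radius (frobenius_companion n p) in
  let c := cos (pi / n%:R) in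
  cmod lam <= w /\
  w <= Num.sqrt (a n.-1 ^+ 2 + 2^-1 * alpha * (a n.-1 + 2^-1 * alpha))
       + Num.sqrt (c ^+ 2 + 2^-1 * (c + 2^-1)).
Proof.
(* A monic constant has no zero, so [n] is positive. *)
case: n p_size => [|m] p_size a alpha w c.
  move: lam_root; have := monicP p_monic; rewrite lead_coefE p_size /= => p0.
  by rewrite [p]size1_polyC ?p_size // rootC p0 oner_eq0.
apply/andP; rewrite /w.
have x_neq0 : \col_(j < m.+1) lam ^+ (m - j) != 0.
  apply/eqP => /colP/(_ ord_max); rewrite !mxE subnn expr0 => /eqP.
  by rewrite oner_eq0.
apply: numerical_radius_eigenvalue x_neq0 _; last exact: companion_eigenvector.
move=> y y_norm; pose Y k := cmod (y (inord k) 0).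
have YE (k : 'I_m.+1) : cmod (y k 0) = Y k by rewrite /Y inord_val.
apply: le_trans (companion_form_le _ _ _ _ _ YE) _.
have Y_ge0 k : 0 <= Y k by exact: cmod_ge0.
have Y1 : \sum_(k < m.+1) Y k ^+ 2 = 1.
  rewrite -[RHS](expr1n _ 2) -y_norm cnormE sqr_sqrtr; last first.
    by apply: sumr_ge0 => i _; exact: sqr_ge0.
  by apply: eq_bigr => i _; rewrite YE.
apply: lerD; last exact: (shift_form_le R m Y).
by apply: (first_row_form_le R m a Y) => //; exact: cmod_ge0.
Qed.
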